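(* Let $(X_0,X_1)$ be a compatible couple and $1<q<\infty$. If $a\in SV(0,\infty)$ satisfies $$\int_0^\infty t^{-1}a^{-q'}(t)\,dt<\infty,$$ then the space $X_0\cap X_1$ is dense in $(X_0,X_1)_{0,q,a;J}$.
   Context: A pair $(X_0,X_1)$ of Banach spaces is a compatible couple if there is a Hausdorff topological vector space in which both $X_0$ and $X_1$ are continuously embedded. $X_0\cap X_1$ carries the norm $\max\{\|f\|_{X_0},\|f\|_{X_1}\}$ and $X_0+X_1$ the norm $\inf\{\|f_0\|_{X_0}+\|f_1\|_{X_1}: f=f_0+f_1\}$. For $f\in X_0\cap X_1$ and $t>0$, $J(f,t;X_0,X_1):=\max\{\|f\|_{X_0},t\|f\|_{X_1}\}$. The conjugate exponent $q'$ is given by $1/q+1/q'=1$. $(X_0,X_1)_{0,q,a;J}$ is the set of $f\in X_0+X_1$ for which there is a strongly measurable $u:(0,\infty)\to X_0\cap X_1$ with $f=\int_0^\infty u(s)\,\frac{ds}{s}$ (convergence in $X_0+X_1$) and for which $\|f\|_{0,q,a;J}:=\inf\|t^{-1/q}a(t)J(u(t),t;X_0,X_1)\|_{q,(0,\infty)}$ is finite, the infimum being over all such representations of $f$; here $\|\cdot\|_{q,(0,\infty)}$ is the $L_q$-norm on $(0,\infty)$. Density is with respect to $\|\cdot\|_{0,q,a;J}$. $SV(0,\infty)$ is the set of slowly varying functions: positive, finite, Lebesgue-measurable functions $b$ on $(0,\infty)$ such that for each $\varepsilon>0$, $t^{\varepsilon}b(t)$ is equivalent to a non-decreasing function on $(0,\infty)$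 and $t^{-\varepsilon}b(t)$ is equivalent to a non-increasing function on $(0,\infty)$. (Two non-negative functions are equivalent if each is bounded by a positive constant multiple of the other.) *)

(* Defs.v *)
From HB Require Import structures.
From mathcomp Require Import all_boot all_order all_algebra.
From mathcomp Require Import all_classical all_reals all_analysis.

Set Implicit Arguments.
Unset Strict Implicit.
Unset Printing Implicit Defensive.

Import Order.TTheory GRing.Theory Num.Def Num.Theory.
Import numFieldNormedType.Exports.

Local Open Scope classical_set_scope.
Local Open Scope ring_scope.

Section bochner.
Context d (T : measurableType d) (R : realType) (E : normedModType R).
Variables (mu : {measure set T -> \bar R}) (D : set T).
Implicit Types (s u : T -> E) (f : E).

Definition is_simple s :=
  finite_set (s @` D) /\ forall y, measurable (D `&` s @^-1` [set y]).

Definition strongly_measurable u :=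
  exists s_ : nat -> T -> E, (forall n, is_simple (s_ n)) /\
    {ae mu, forall x, D x -> s_ n x @[n --> \oo] --> u x}.

Definition is_integrable_simple s :=
  is_simple s /\ forall y, y != 0 -> (mu (D `&` s @^-1` [set y]) < +oo)%E.

(* The term y = 0 vanishes also when the level set of 0 has infinite
   measure. *)
Definition simple_integral s : E :=
  \sum_(y \in s @` D) fine (mu (D `&` s @^-1` [set y])) *: y.

Definition is_bochner_integral u f :=
  strongly_measurable u /\
  exists s_ : nat -> T -> E,
    [/\ forall n, is_integrable_simple (s_ n),
        (\int[mu]_(x in D) `|u x - s_ n x|%:E)%E @[n --> \oo] --> 0%E &
        simple_integral (s_ n) @[n --> \oo] --> f].

End bochner.

Record compatible_couple (R : realType) := CompatibleCouple {
  space0 : completeNormedModType R ;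
  space1 : completeNormedModType R ;
  ambient : topologicalLmodType R ;
  ambient_hausdorff : hausdorff_space ambient ;
  embed0 : {linear space0 -> ambient} ;
  embed1 : {linear space1 -> ambient} ;
  embed0_inj : injective embed0 ;
  embed1_inj : injective embed1 ;
  embed0_continuous : continuous embed0 ;
  embed1_continuous : continuous embed1 }.

(** An element of the intersection is stored as the pair of its avatars in the
    two spaces. *)
Section intersection_space.
Context (R : realType) (X : compatible_couple R).

Definition inter_pred : {pred space0 X * space1 X} :=
  fun p => embed0 X p.1 == embed1 X p.2.

Lemma inter_submod_closed : submod_closed inter_pred.
Proof.
split=> [|a x y]; first by rewrite /inter_pred unfold_in /= !linear0.
by rewrite /inter_pred !unfold_in /= !linearP => /eqP -> /eqP ->.
Qed.

HB.instance Definition _ :=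
  GRing.isSubmodClosed.Build R (space0 X * space1 X)%type inter_pred
    inter_submod_closed.

Record inter_space := InterSpace {
  inter_val :> space0 X * space1 X ;
  inter_valP : inter_val \in inter_pred }.

HB.instance Definition _ := [isSub for inter_val].
HB.instance Definition _ := [Choice of inter_space by <:].
HB.instance Definition _ := [SubChoice_isSubLmodule of inter_space by <:].

Definition inter_norm (f : inter_space) : R := maxr `|f.1| `|f.2|.

Lemma inter_normD f g : inter_norm (f + g) <= inter_norm f + inter_norm g.
Proof.
rewrite /inter_norm ge_max; apply/andP; split.
  by apply: (le_trans (ler_normD _ _)); apply: lerD; rewrite le_max lexx.
by apply: (le_trans (ler_normD _ _)); apply: lerD; rewrite le_max lexx orbT.
Qed.

Lemma inter_normZ (a : R) f : inter_norm (a *: f) = `|a| * inter_norm f.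
Proof. by rewrite /inter_norm /= !normrZ maxr_pMr. Qed.

Lemma inter_norm_eq0 f : inter_norm f = 0 -> f = 0.
Proof.
move=> f0; apply/val_inj => /=; case: f f0 => -[x y] xy /=.
rewrite /inter_norm /= => m0.
have : maxr `|x| `|y| <= 0 by rewrite m0.
by rewrite ge_max !normr_le0 => /andP[/eqP -> /eqP ->].
Qed.

HB.instance Definition _ := Lmodule_isNormed.Build R inter_space
  inter_normD inter_normZ inter_norm_eq0.

End intersection_space.

Section sum_space.
Context (R : realType) (X : compatible_couple R).

Definition decomposes (z : ambient X) (x : space0 X * space1 X) :=
  z = embed0 X x.1 + embed1 X x.2.

Definition sum_pred : {pred ambient X} :=
  fun z => `[< exists x, decomposes z x >].

Lemma sum_submod_closed : submod_closed sum_pred.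
Proof.
split=> [|a x y].
  by rewrite unfold_in; apply/asboolP; exists 0; rewrite /decomposes !linear0 addr0.
rewrite !unfold_in => /asboolP[u ->] /asboolP[v ->].
apply/asboolP; exists (a *: u + v).
by rewrite /decomposes /= !linearP /= scalerDr addrACA.
Qed.

HB.instance Definition _ :=
  GRing.isSubmodClosed.Build R (ambient X) sum_pred sum_submod_closed.

Record sum_space := SumSpace {
  sum_val :> ambient X ;
  sum_valP : sum_val \in sum_pred }.

HB.instance Definition _ := [isSub for sum_val].
HB.instance Definition _ := [Choice of sum_space by <:].
HB.instance Definition _ := [SubChoice_isSubLmodule of sum_space by <:].

Definition sum_norms (f : sum_space) : set R :=
  [set `|x.1| + `|x.2| | x in decomposes (sum_val f)].

Definition sum_norm (f : sum_space) : R := inf (sum_norms f).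

Lemma sum_norms_nonempty f : sum_norms f !=set0.
Proof.
have := sum_valP f; rewrite unfold_in => /asboolP[x fx].
by exists (`|x.1| + `|x.2|), x.
Qed.

Lemma sum_norms_lbound f : lbound (sum_norms f) 0.
Proof. by move=> _ [x _ <-]; rewrite addr_ge0. Qed.

Lemma sum_norms_has_inf f : has_inf (sum_norms f).
Proof.
by split; [exact: sum_norms_nonempty|exists 0; exact: sum_norms_lbound].
Qed.

Lemma sum_norm_le f x :
  decomposes (sum_val f) x -> sum_norm f <= `|x.1| + `|x.2|.
Proof.
move=> fx; apply: ge_inf; last by exists x.
by exists 0; exact: sum_norms_lbound.
Qed.

Lemma sum_norm_ge0 f : 0 <= sum_norm f.
Proof. apply: lb_le_inf; [exact: sum_norms_nonempty|exact: sum_norms_lbound]. Qed.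

Lemma sum_normD f g : sum_norm (f + g) <= sum_norm f + sum_norm g.
Proof.
apply/ler_addgt0Pr => e e0.
have e20 : 0 < e / 2 by rewrite divr_gt0.
have [_ [x fx <-] xlt] := inf_adherent e20 (sum_norms_has_inf f).
have [_ [y gy <-] ylt] := inf_adherent e20 (sum_norms_has_inf g).
have fgxy : decomposes (sum_val (f + g)) (x + y).
  by rewrite /decomposes /= fx gy !linearD /= addrACA.
apply: (le_trans (sum_norm_le fgxy)).
apply: (@le_trans _ _ ((`|x.1| + `|x.2|) + (`|y.1| + `|y.2|))).
  by rewrite addrACA lerD// ler_normD.
apply: (le_trans (lerD (ltW xlt) (ltW ylt))).
by rewrite addrACA -splitr.
Qed.

Lemma sum_normZ_le (a : R) f : sum_norm (a *: f) <= `|a| * sum_norm f.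
Proof.
have [->|a0] := eqVneq a 0.
  have /sum_norm_le : decomposes (sum_val (0 *: f : sum_space)) 0.
    by rewrite /decomposes /= scale0r !linear0 addr0.
  by rewrite /= !normr0 addr0 mul0r.
have ap : 0 < `|a| by rewrite normr_gt0.
rewrite mulrC -ler_pdivrMr//; apply: lb_le_inf; first exact: sum_norms_nonempty.
move=> _ [x fx <-]; rewrite ler_pdivrMr//.
have /sum_norm_le : decomposes (sum_val (a *: f)) (a *: x).
  by rewrite /decomposes /= fx scalerDr !linearZ.
by rewrite /= !normrZ -mulrDr mulrC.
Qed.

Lemma sum_normZ (a : R) f : sum_norm (a *: f) = `|a| * sum_norm f.
Proof.
apply/eqP; rewrite eq_le sum_normZ_le /=.
have [->|a0] := eqVneq a 0; first by rewrite normr0 mul0r sum_norm_ge0.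
have ap : 0 < `|a| by rewrite normr_gt0.
rewrite -{1}(scale1r f) -(mulVf a0) -scalerA -ler_pdivlMl//.
by rewrite -normfV sum_normZ_le.
Qed.

Lemma sum_norm_eq0 f : sum_norm f = 0 -> f = 0.
Proof.
move=> f0; apply/val_inj => /=.
pose e (n : nat) : R := n.+1%:R^-1.
have e0 n : 0 < e n by rewrite invr_gt0.
have /choice[x xP] : forall n, exists x,
    decomposes (sum_val f) x /\ `|x.1| + `|x.2| < e n.
  move=> n; have [_ [x fx <-]] := inf_adherent (e0 n) (sum_norms_has_inf f).
  by rewrite -/(sum_norm f) f0 add0r => xe; exists x.
have x1 : (x n).1 @[n --> \oo] --> (0 : space0 X).
  apply/cvgr0Pnorm_lt => eps eps0.
  have := @near_infty_natSinv_lt R (PosNum eps0); apply: filterS => n /= ne.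
  apply: (lt_trans _ ne); apply: le_lt_trans (xP n).2.
  by rewrite lerDl.
have x2 : (x n).2 @[n --> \oo] --> (0 : space1 X).
  apply/cvgr0Pnorm_lt => eps eps0.
  have := @near_infty_natSinv_lt R (PosNum eps0); apply: filterS => n /= ne.
  apply: (lt_trans _ ne); apply: le_lt_trans (xP n).2.
  by rewrite lerDr.
have y1 : embed0 X (x n).1 @[n --> \oo] --> (0 : ambient X).
  rewrite -(linear0 (embed0 X)).
  exact: (cvg_comp _ _ x1 (@embed0_continuous _ X 0)).
have y2 : embed1 X (x n).2 @[n --> \oo] --> (0 : ambient X).
  rewrite -(linear0 (embed1 X)).
  exact: (cvg_comp _ _ x2 (@embed1_continuous _ X 0)).
have : sum_val f @[n --> \oo] --> (0 : ambient X).
  rewrite -[X in _ --> X]addr0.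
  have -> : (fun _ : nat => sum_val f) =
      (fun n => embed0 X (x n).1 + embed1 X (x n).2).
    by apply/funext => n; exact: (xP n).1.
  apply: (@cvg_comp _ _ _
    (fun n => (embed0 X (x n).1, embed1 X (x n).2))
    (fun p : ambient X * ambient X => p.1 + p.2) _ (nbhs (0, 0))).
    exact: cvg_pair.
  exact: (@add_continuous (ambient X) (0, 0)).
move=> f0'; apply: (@cvg_unique _ (@ambient_hausdorff _ X)
  ((fun _ : nat => sum_val f) @ \oo)) => //.
exact: cvg_cst.
Qed.

HB.instance Definition _ := Lmodule_isNormed.Build R sum_space
  sum_normD sum_normZ sum_norm_eq0.

Lemma inter_in_sum (f : inter_space X) : embed0 X f.1 \in sum_pred.
Proof.
rewrite unfold_in; apply/asboolP; exists (f.1, 0).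
by rewrite /decomposes /= linear0 addr0.
Qed.

(* embed0 X f.1 is also embed1 X f.2. *)
Definition inter_sum (f : inter_space X) : sum_space :=
  SumSpace (inter_in_sum f).

End sum_space.

(** Functions on the half-line are considered with respect to the completed
    Lebesgue measure, i.e. measurability is Lebesgue (not Borel)
    measurability. *)
Definition lebesgue_line (R : realType) :=
  caratheodory_type ((@wlength R idfun)^*)%mu.

Definition half_line (R : realType) : set R := `]0, +oo[%classic.

Section slowly_varying.
Context (R : realType).
Implicit Types f g b : R -> R.

(* Comparability of f and g on the half-line; if f is positive there, then so
   is g. *)
Definition equivalent f g :=
  (exists2 c, 0 < c & forall t, half_line t -> f t <= c * g t) /\
  (exists2 c, 0 < c & forall t, half_line t -> g t <= c * f t).

Definition nondecreasing_on_half_line g :=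
  forall s t, half_line s -> half_line t -> s <= t -> g s <= g t.

Definition nonincreasing_on_half_line g :=
  forall s t, half_line s -> half_line t -> s <= t -> g t <= g s.

Definition slowly_varying b :=
  [/\ forall t, half_line t -> 0 < b t,
      measurable_fun (@half_line R : set (lebesgue_line R)) b &
      forall e, 0 < e ->
        (exists2 g, nondecreasing_on_half_line g &
           equivalent (fun t => t `^ e * b t) g) /\
        (exists2 g, nonincreasing_on_half_line g &
           equivalent (fun t => t `^ (- e) * b t) g)].

End slowly_varying.

Section J_space.
Context (R : realType) (X : compatible_couple R).
Variables (q : R) (a : R -> R).

Let mu := @completed_lebesgue_measure R.

Definition J_functional (f : inter_space X) (t : R) : R :=
  maxr `|f.1| (t * `|f.2|).

(* The integral against ds/s is the Bochner integral of u(s)/s against ds. *)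
Definition J_representation (f : sum_space X) (u : R -> inter_space X) :=
  @strongly_measurable _ (lebesgue_line R) R _ mu (@half_line R) u /\
  @is_bochner_integral _ (lebesgue_line R) R _ mu (@half_line R)
    (fun s => s^-1 *: inter_sum (u s)) f.

Definition J_weighted (u : R -> inter_space X) (t : R) : R :=
  t `^ (- q^-1) * a t * J_functional (u t) t.

Definition J_weighted_norm (u : R -> inter_space X) : \bar R :=
  ('N[mu]_q%:E[EFin \o (J_weighted u \_ (@half_line R))])%E.

(* Equal to +oo when f has no representation. *)
Definition J_norm (f : sum_space X) : \bar R :=
  ereal_inf [set J_weighted_norm u | u in J_representation f].

Definition J_space : set (sum_space X) :=
  [set f | (exists u, J_representation f u) /\ (J_norm f < +oo)%E].

End J_space.

Definition dense_for (R : realType) (V : zmodType) (N : V -> \bar R)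
    (S A : set V) :=
  A `<=` S /\
  forall f, S f -> forall e : R, 0 < e ->
    exists2 g, A g & (N (f - g)%R < e%:E)%E.

(* Main.v *)
Require Import Defs.
From HB Require Import structures.
From mathcomp Require Import all_boot all_order all_algebra.
From mathcomp Require Import finmap.
From mathcomp Require Import all_classical all_reals all_analysis.
From mathcomp Require Import measurable_realfun.

Set Implicit Arguments.
Unset Strict Implicit.
Unset Printing Implicit Defensive.

Import Order.TTheory GRing.Theory Num.Def Num.Theory.
Import numFieldNormedType.Exports.

Local Open Scope classical_set_scope.
Local Open Scope ring_scope.

(** Let [u] represent [f] in the J-space with finite weighted norm.  Choose
    [(X_0 /\ X_1)]-valued simple functions [t_n] with [s t_n(s) -> u(s)] almost
    everywhere.  Since the measure is [ds/s], the function [s |-> s t_n(s)]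
    represents [inter_sum (int t_n(s) ds)], which lies in the intersection
    because the integral of a simple function is a finite sum; no Bochner
    integral in the intersection has to be built.  Hence [u - s t_n] represents
    the difference between [f] and an element of the intersection, and it
    remains to make its weighted norm small.

    For this, reset [t_n(s)] to [0] wherever [s > n] or
    [J(u(s) - s t_n(s), s) > J(u(s), s)].  The first cut makes [t_n]
    integrable.  The second one gives [J(u(s) - s t_n(s), s) <= J(u(s), s)] for
    all [s], and the left-hand side still tends to [0]: where [J(u(s), s) > 0]
    the cut is eventually inactive, and where [J(u(s), s) = 0] the bound itself
    is [0] ([simple_J_approximation]).  So the weighted norms of
    [u - s t_n] tend to [0] by dominated convergence, the dominating function
    being the weighted integrand of [u] ([J_weighted_norm_cvg0]).

    That the intersection is contained in the J-space is seen on the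
    representation [s |-> s 1_{]1, 2]}(s) f] of one of its elements [f], whose
    weighted norm is finite because a slowly varying function is bounded on
    compact subintervals of the half-line ([range_inter_sum_sub_J_space]).

    The measurability of [s |-> J(u(s), s)] comes from
    [strongly_measurable_caratheodory], and the manipulation of simple
    functions from [simple_integral_comp]. *)

(** * Functions with finitely many values *)

Section finitely_valued.
Context d (T : measurableType d) (D : set T).

(** The condition of [is_simple] without a norm on the codomain, so that it
    also applies to pairs of simple functions and to membership tests. *)
Definition finitely_valued (I : Type) (h : T -> I) :=
  finite_set (h @` D) /\ forall i, measurable (D `&` h @^-1` [set i]).

Lemma preimage_fibers (I : Type) (h : T -> I) (Z : set I) :
  D `&` h @^-1` Z = \bigcup_(i in (h @` D) `&` Z) (D `&` h @^-1` [set i]).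
Proof.
apply/seteqP; split=> [t [Dt Zt]|t [i [_ Zi] [Dt hti]]].
  by exists (h t) => //; split => //; exists t.
by split=> //=; rewrite /preimage /= hti.
Qed.

Lemma finitely_valued_comp (I J : Type) (h : T -> I) (g : I -> J) :
  finitely_valued h -> finitely_valued (g \o h).
Proof.
move=> [fh mh]; split=> [|j]; first by rewrite -image_comp; exact: finite_image.
rewrite comp_preimage preimage_fibers; apply: fin_bigcup_measurable => //.
exact: finite_setIl.
Qed.

Lemma finitely_valued_pair (I J : Type) (h : T -> I) (k : T -> J) :
  finitely_valued h -> finitely_valued k ->
  finitely_valued (fun t => (h t, k t)).
Proof.
move=> [fh mh] [fk mk]; split=> [|[i j]].
  apply: sub_finite_set (finite_setX fh fk) => _ [t Dt <-].
  by split; exists t.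
rewrite (_ : _ `&` _ = (D `&` h @^-1` [set i]) `&` (D `&` k @^-1` [set j])).
  exact: measurableI.
by apply/seteqP; split=> t /=; [move=> [Dt [-> ->]]|move=> [[Dt ->] [_ ->]]].
Qed.

Lemma finitely_valued_mem (A : set T) :
  measurable D -> measurable A -> finitely_valued (fun t => t \in A).
Proof.
move=> mD mA; split=> [|[]].
- exact: finite_finset.
- by apply: measurableI => //; rewrite preimage_mem_true.
- apply: measurableI => //; rewrite preimage_mem_false; exact: measurableC.
Qed.

(** On each of the finitely many level sets of [h] the function is one of the
    [phi i]. *)
Lemma measurable_fun_finitely_valued d' (T' : measurableType d') (I : Type)
    (h : T -> I) (phi : I -> T -> T') :
  finitely_valued h -> (forall i, measurable_fun D (phi i)) ->
  measurable_fun D (fun t => phi (h t) t).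
Proof.
move=> [fh mh] mphi mD Y mY.
rewrite (_ : _ `&` _ = \bigcup_(i in h @` D)
    ((D `&` h @^-1` [set i]) `&` (D `&` phi i @^-1` Y))).
  by apply: fin_bigcup_measurable => // i _; apply: measurableI => //; exact: mphi.
apply/seteqP; split=> [t [Dt Yt]|t [i _ [[Dt <-] [_ Yt]]]] //.
by exists (h t) => //; exists t.
Qed.

End finitely_valued.

(** * Simple functions and the Bochner integral *)

Section simple_integral.
Context d (T : measurableType d) (R : realType) (E : normedModType R).
Variables (mu : {measure set T -> \bar R}) (D : set T).

(** A level set of [g \o h] is a finite union of level sets of [h].  Those with
    [g i = 0] may have infinite measure, since the level [0] of a simple
    function is unconstrained. *)
Lemma is_integrable_simple_comp (I : Type) (h : T -> I) (g : I -> E) :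
  finitely_valued D h ->
  (forall i, g i != 0 -> (mu (D `&` h @^-1` [set i]) < +oo)%E) ->
  is_integrable_simple mu D (g \o h).
Proof.
move=> [fh mh] goo; split; first exact: (finitely_valued_comp g (conj fh mh)).
elim/Pchoice: I => I in h g fh mh goo *.
move=> y y0; rewrite comp_preimage preimage_fibers.
rewrite measure_fin_bigcup//; last 2 first.
- exact: finite_setIl.
- apply/trivIsetP => i j _ _ /eqP ij.
  by apply/seteqP; split=> // t [[_ ti] [_ tj]]; case: ij; rewrite -ti -tj.
rewrite fsbig_finite; last exact: finite_setIl.
rewrite big_seq; apply: lte_sum_pinfty => i.
rewrite in_fset_set ?inE; last exact: finite_setIl.
by move=> [_ gi]; apply: goo; rewrite gi.
Qed.

(** Taking for [h] a pair of simple functions, or a simple function before a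
    linear map, this reduces every identity between simple integrals to a
    termwise identity of sums indexed by the values of the same [h]. *)
Lemma simple_integral_comp (I : choiceType) (h : T -> I) (g : I -> E) :
  finitely_valued D h ->
  (forall i, g i != 0 -> (mu (D `&` h @^-1` [set i]) < +oo)%E) ->
  simple_integral mu D (g \o h) =
  \sum_(i \in h @` D) fine (mu (D `&` h @^-1` [set i])) *: g i.
Proof.
move=> [fh mh] goo; rewrite /simple_integral.
have fgh : finite_set ((g \o h) @` D) by rewrite -image_comp; exact: finite_image.
have levelE y : fine (mu (D `&` (g \o h) @^-1` [set y])) *: y =
    \sum_(i <- fset_set (h @` D) | g i == y)
      fine (mu (D `&` h @^-1` [set i])) *: g i.
  have [->|y0] := eqVneq y 0.
    by rewrite scaler0 big1// => i /eqP ->; rewrite scaler0.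
  rewrite comp_preimage preimage_fibers measure_fin_bigcup//; last 2 first.
  - exact: finite_setIl.
  - apply/trivIsetP => i j _ _ /eqP ij.
    by apply/seteqP; split=> // t [[_ ti] [_ tj]]; case: ij; rewrite -ti -tj.
  have -> : (\sum_(i \in h @` D `&` g @^-1` [set y])
      mu (D `&` h @^-1` [set i]) =
    \sum_(i <- fset_set (h @` D) | g i == y) mu (D `&` h @^-1` [set i]))%E.
    rewrite fsbig_mkcondr fsbig_finite// -big_mkcond /=.
    by apply: eq_bigl => i; apply/idP/eqP; rewrite inE.
  rewrite -sum_fine; last first.
    by move=> i /eqP gi; rewrite ge0_fin_numE//; apply: goo; rewrite gi.
  by rewrite scaler_suml; apply: eq_bigr => i /eqP ->.
rewrite !fsbig_finite//; under eq_bigr do rewrite levelE.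
rewrite (exchange_big_dep xpredT) //=; apply: eq_big_seq => i.
rewrite in_fset_set// inE => hi.
rewrite (eq_bigl (pred1 (g i))) => [|y]; last by rewrite /= eq_sym.
rewrite -big_filter filter_pred1_uniq ?big_seq1 ?fset_uniq//.
rewrite in_fset_set// inE -image_comp; case: hi => t Dt <-.
by exists (h t) => //; exists t.
Qed.

End simple_integral.

Section bochner_simple.
Context d (T : measurableType d) (R : realType) (E : normedModType R).
Variables (mu : {measure set T -> \bar R}) (D : set T).
Hypothesis mD : measurable D.
Implicit Types (s t u v : T -> E) (f : E).

(* Only the common zero set of two integrable simple functions can have infinite
   measure. *)
Let finite_level_pair s t (p : E * E) :
  is_integrable_simple mu D s -> is_integrable_simple mu D t -> p != 0 ->
  (mu (D `&` (fun x => (s x, t x)) @^-1` [set p]) < +oo)%E.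
Proof.
case: p => y z [ss soo] [st too] yz0.
have mst := (finitely_valued_pair ss st).2 (y, z).
have [y0|y0] := eqVneq y 0; last first.
  apply: le_lt_trans (soo _ y0); apply: le_measure; rewrite ?inE//.
    exact: ss.2.
  by move=> x [Dx [<- _]].
have z0 : z != 0 by apply: contraNneq yz0 => ->; rewrite y0.
apply: le_lt_trans (too _ z0); apply: le_measure; rewrite ?inE//.
  exact: st.2.
by move=> x [Dx [_ <-]].
Qed.

Lemma is_integrable_simpleB s t :
  is_integrable_simple mu D s -> is_integrable_simple mu D t ->
  is_integrable_simple mu D (fun x => s x - t x).
Proof.
move=> ss st.
apply: (is_integrable_simple_comp (g := fun p : E * E => p.1 - p.2)
  (finitely_valued_pair ss.1 st.1)) => p p0.
apply: finite_level_pair => //; apply: contraNneq p0 => ->.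
by rewrite subrr.
Qed.

Lemma simple_integralB s t :
  is_integrable_simple mu D s -> is_integrable_simple mu D t ->
  simple_integral mu D (fun x => s x - t x) =
  simple_integral mu D s - simple_integral mu D t.
Proof.
move=> ss st; have fst_ := finitely_valued_pair ss.1 st.1.
have goo (g : E * E -> E) : g 0 = 0 -> forall p, g p != 0 ->
    (mu (D `&` (fun x => (s x, t x)) @^-1` [set p]) < +oo)%E.
  move=> g0 p p0; apply: finite_level_pair => //.
  by apply: contraNneq p0 => ->; rewrite g0.
have -> := simple_integral_comp (g := fun p : E * E => p.1 - p.2) fst_
  (goo _ (subrr _)).
have -> := simple_integral_comp (g := fst) fst_ (goo _ erefl).
have -> := simple_integral_comp (g := snd) fst_ (goo _ erefl).
have [ff _] := fst_; rewrite !fsbig_finite//= -sumrB.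
by apply: eq_bigr => p _; rewrite scalerBr.
Qed.

Lemma strongly_measurable_simple s :
  is_simple D s -> strongly_measurable mu D s.
Proof.
by move=> ss; exists (fun=> s); split=> //; apply: aeW => x _; exact: cvg_cst.
Qed.

Lemma strongly_measurableB u v :
  strongly_measurable mu D u -> strongly_measurable mu D v ->
  strongly_measurable mu D (fun x => u x - v x).
Proof.
move=> [s [ss su]] [t [st tv]]; exists (fun n x => s n x - t n x); split.
  move=> n; exact: (finitely_valued_comp (fun p : E * E => p.1 - p.2)
    (finitely_valued_pair (ss n) (st n))).
apply: filterS2 su tv => x sx tx Dx; exact: cvgB (sx Dx) (tx Dx).
Qed.

Import HBSimple.

Lemma strongly_measurableZ (phi : T -> R) u :
  measurable_fun D phi -> strongly_measurable mu D u ->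
  strongly_measurable mu D (fun x => phi x *: u x).
Proof.
move=> /measurable_EFinP mphi [s [ss su]].
have [g gphi] := approximation_sfun mD mphi.
exists (fun n x => g n x *: s n x); split.
  move=> n; apply: (finitely_valued_comp (fun p : R * E => p.1 *: p.2)
    (finitely_valued_pair _ (ss n))); split=> [|y].
    by apply: sub_finite_set (fimfunP (g n)) => _ [x _ <-]; exists x.
  by apply: measurableI.
apply: filterS su => x sx Dx; apply: cvgZ (sx Dx).
by have /fine_cvgP[_] := gphi x Dx.
Qed.

Lemma is_bochner_integral_simple s :
  is_integrable_simple mu D s ->
  is_bochner_integral mu D s (simple_integral mu D s).
Proof.
move=> ss; split; first exact: strongly_measurable_simple ss.1.
exists (fun=> s); split=> //; last exact: cvg_cst.
under eq_fun do under eq_integral do rewrite subrr normr0.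
by rewrite integral0; exact: cvg_cst.
Qed.

(** If the [s_n] approximate [u], then the [s_n - t] approximate [u - t] with
    the very same errors, so neither a triangle inequality for integrals nor the
    measurability of the errors is involved. *)
Lemma is_bochner_integralB_simple u f t :
  is_bochner_integral mu D u f -> is_integrable_simple mu D t ->
  is_bochner_integral mu D (fun x => u x - t x) (f - simple_integral mu D t).
Proof.
move=> [mu_ [s [ss su sf]]] st; split.
  exact: strongly_measurableB (strongly_measurable_simple st.1).
exists (fun n x => s n x - t x); split=> [n||].
- exact: is_integrable_simpleB.
- apply: cvg_trans su; apply: near_eq_cvg; near=> n.
  apply: eq_integral => x _; congr (`| _ |%:E).
  by rewrite opprB addrA subrK.
- apply: cvg_trans (cvgB sf (cvg_cst _)); apply: near_eq_cvg; near=> n.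
  by rewrite /= simple_integralB.
Unshelve. all: by end_near. Qed.

(** For simple [u] the values of [phi (u x) x] are glued from finitely many
    sections [phi y]; continuity in the first variable passes to the limit.
    The limit holds off a null set only, and completeness of the measure takes
    care of the exceptional set. *)
Lemma strongly_measurable_caratheodory (phi : E -> T -> R) u :
  measure_is_complete mu ->
  (forall y, measurable_fun D (phi y)) ->
  (forall x, D x -> continuous (phi^~ x)) ->
  strongly_measurable mu D u -> measurable_fun D (fun x => phi (u x) x).
Proof.
move=> cmu mphi cphi [s [ss [N [mN N0 sN]]]].
(* phi, replaced by 0 on the exceptional null set, which the bit p.2 marks *)
pose off (p : E * bool) x := if p.2 then 0 else phi p.1 x.
apply/measurable_EFinP.
apply: (@ae_measurable_fun _ _ _ mu cmu D
  (fun x => (off (u x, x \in N) x)%:E)).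
  exists N; split=> // x; apply: contra_notP => Nx Dx.
  by rewrite /off/= memNset.
apply/measurable_EFinP.
apply: (@measurable_fun_cvg _ _ _ D (fun n x => off (s n x, x \in N) x)).
  move=> n; apply: measurable_fun_finitely_valued.
    apply: (finitely_valued_pair (ss n)); exact: finitely_valued_mem.
  by move=> [y [|]]; [exact: measurable_cst|exact: mphi].
move=> x Dx; rewrite /off/=; case: ifPn => [_|/negP xN]; first exact: cvg_cst.
have sx : s n x @[n --> \oo] --> u x.
  by apply: contrapT => nsx; apply: xN; rewrite inE; apply: sN => /(_ Dx).
exact: (cvg_comp _ _ sx (cphi _ Dx _)).
Qed.

End bochner_simple.

Section linear_bochner.
Context d (T : measurableType d) (R : realType) (E F : normedModType R).
Variables (mu : {measure set T -> \bar R}) (D : set T) (L : {linear E -> F}).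

Let finite_level_linear s y : is_integrable_simple mu D s -> L y != 0 ->
  (mu (D `&` s @^-1` [set y]) < +oo)%E.
Proof.
by move=> ss Ly; apply: ss.2; apply: contraNneq Ly => ->; rewrite linear0.
Qed.

Lemma is_integrable_simple_linear s :
  is_integrable_simple mu D s -> is_integrable_simple mu D (fun x => L (s x)).
Proof.
move=> ss; apply: (is_integrable_simple_comp (g := L) ss.1) => y.
exact: finite_level_linear.
Qed.

Lemma simple_integral_linear s : is_integrable_simple mu D s ->
  simple_integral mu D (fun x => L (s x)) = L (simple_integral mu D s).
Proof.
move=> ss; have -> := simple_integral_comp (g := L) ss.1
  (fun y => finite_level_linear ss).
rewrite /simple_integral !fsbig_finite; [|exact: ss.1.1..].
by rewrite linear_sum; apply: eq_bigr => y _; rewrite linearZ.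
Qed.

Lemma eq_strongly_measurable (u v : T -> E) :
  {in D, u =1 v} -> strongly_measurable mu D u -> strongly_measurable mu D v.
Proof.
move=> uv [s [ss su]]; exists s; split=> //.
by apply: filterS su => x sx Dx; rewrite -uv ?inE//; exact: sx.
Qed.

Lemma eq_is_bochner_integral (u v : T -> E) f :
  {in D, u =1 v} -> is_bochner_integral mu D u f -> is_bochner_integral mu D v f.
Proof.
move=> uv [mu_ [s [ss su sf]]]; split; first exact: eq_strongly_measurable mu_.
exists s; split=> //; apply: cvg_trans su; apply: near_eq_cvg; near=> n.
by apply: eq_integral => x xD; rewrite uv.
Unshelve. all: by end_near. Qed.

End linear_bochner.

(** * Completed Lebesgue measure on the half-line *)

Section half_line.
Context (R : realType).
Local Notation line := (lebesgue_line R).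
Local Notation mu := (@completed_lebesgue_measure R).
Local Notation D := (@half_line R : set line).

Lemma measurable_line (A : set R) :
  measurable A -> measurable (A : set line).
Proof. exact: sub_caratheodory. Qed.

Lemma measurable_half_line : measurable D.
Proof. by apply: measurable_line; exact: measurable_itv. Qed.

Lemma measurable_fun_line (f : R -> R) :
  measurable_fun setT f -> measurable_fun D (f : line -> R).
Proof.
move=> mf _ Y mY; apply: measurableI; first exact: measurable_half_line.
by apply: measurable_line; rewrite -[X in measurable X]setTI; exact: mf.
Qed.

Lemma completed_lebesgue_measure_oc (x y : R) :
  x <= y -> mu (`]x, y]%classic : set line) = (y - x)%:E.
Proof.
move=> xy; rewrite -[RHS](wlength_itv_bnd idfun false false xy).
exact: (@measurable_mu_extE _ R (ocitv_type R) (wlength idfun) _ (is_ocitv x y)).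
Qed.

End half_line.

(** * The J-functional *)

Section J_functional.
Context (R : realType) (X : compatible_couple R).
Implicit Types (f g : inter_space X) (t : R).

Lemma J_functional_ge0 f t : 0 <= J_functional f t.
Proof. by rewrite le_max normr_ge0. Qed.

Lemma J_functional0 t : J_functional (0 : inter_space X) t = 0.
Proof. by rewrite /J_functional /= !normr0 mulr0 maxxx. Qed.

Lemma J_functional_continuous t : continuous (fun f => J_functional f t).
Proof.
have near_ball f e : 0 < e -> \forall g \near f, `|f - g| <= e.
  by move=> e0; apply/nbhs_normP; exists e => // g /ltW.
have fst_cont : continuous (fun f : inter_space X => f.1).
  move=> f; apply: (iffRL (@cvgrPdist_le _ _ _ _ (nbhs_filter f) _ _)) => e e0.
  apply: filterS (near_ball f e e0) => g; apply: le_trans.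
  by rewrite [leRHS]/Num.norm/= le_max lexx.
have snd_cont : continuous (fun f : inter_space X => f.2).
  move=> f; apply: (iffRL (@cvgrPdist_le _ _ _ _ (nbhs_filter f) _ _)) => e e0.
  apply: filterS (near_ball f e e0) => g; apply: le_trans.
  by rewrite [leRHS]/Num.norm/= le_max lexx orbT.
move=> f; apply: (@max_fun_continuous _ _ R (fun f : inter_space X => `|f.1|)
  (fun f : inter_space X => t * `|f.2|)) => g.
  exact: continuous_comp (fst_cont g) (@norm_continuous _ _ _).
apply: (@continuous_comp _ _ _ (fun f : inter_space X => `|f.2|) ( *%R t)).
  exact: continuous_comp (snd_cont g) (@norm_continuous _ _ _).
exact: mulrl_continuous.
Qed.

Let measurable_J_functional_cst f :
  measurable_fun (@half_line R : set (lebesgue_line R))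
    (fun t => J_functional f t).
Proof.
by apply: measurable_fun_line; apply: measurable_maxr => //; exact: mulrr_measurable.
Qed.

Lemma measurable_J_functional (u : lebesgue_line R -> inter_space X) :
  strongly_measurable (@completed_lebesgue_measure R) (@half_line R) u ->
  measurable_fun (@half_line R : set (lebesgue_line R))
    (fun t => J_functional (u t) t).
Proof.
move=> mu; apply: (strongly_measurable_caratheodory (@measurable_half_line R)
  (phi := fun f (t : lebesgue_line R) => J_functional f t) _ _ _ mu).
- exact: completed_lebesgue_measure_is_complete.
- exact: measurable_J_functional_cst.
- by move=> t _; exact: J_functional_continuous.
Qed.

End J_functional.

(** * J-representations *)

Section representation.
Context (R : realType) (X : compatible_couple R).
Local Notation line := (lebesgue_line R).
Local Notation mu := (@completed_lebesgue_measure R).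
Local Notation D := (@half_line R : set line).
Implicit Types (t u : line -> inter_space X) (f : sum_space X).

Lemma inter_sum_linear : linear (@inter_sum R X).
Proof. by move=> k f g; apply/val_inj; rewrite /= linearP. Qed.

HB.instance Definition _ := GRing.isLinear.Build R (inter_space X) (sum_space X)
  _ (@inter_sum R X) inter_sum_linear.

Lemma inter_sumZ k (f : inter_space X) : inter_sum (k *: f) = k *: inter_sum f.
Proof. by apply/val_inj; rewrite /= linearZ. Qed.

Lemma half_line_gt0 (s : R) : half_line s = (0 < s) :> Prop.
Proof. by rewrite /half_line /= in_itv/= andbT. Qed.

Lemma strongly_measurable_mul_id t : strongly_measurable mu D t ->
  strongly_measurable mu D (fun s => (s : R) *: t s).
Proof.
apply: strongly_measurableZ; first exact: measurable_half_line.
exact: measurable_fun_line.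
Qed.

Let cancel_weight u t : {in D, (fun s : line => (s : R)^-1 *: inter_sum (u s)
    - inter_sum (t s)) =1
  fun s => (s : R)^-1 *: inter_sum (u s - (s : R) *: t s)}.
Proof.
move=> s; rewrite inE half_line_gt0 => s0.
by rewrite linearB/= scalerBr inter_sumZ scalerA mulVf ?scale1r// gt_eqF.
Qed.

(** The factor [s] cancels the density of [ds/s], so the integrand is a simple
    function and its integral is a finite sum of elements of the
    intersection. *)
Lemma J_representation_simple t : is_integrable_simple mu D t ->
  J_representation (inter_sum (simple_integral mu D t)) (fun s => s *: t s).
Proof.
move=> st; split.
  exact: strongly_measurable_mul_id (strongly_measurable_simple _ st.1).
rewrite -simple_integral_linear//.
have := is_bochner_integral_simple
  (is_integrable_simple_linear (@inter_sum R X) st).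
apply: eq_is_bochner_integral => s; rewrite inE half_line_gt0 => s0.
by rewrite inter_sumZ scalerA mulVf ?scale1r// gt_eqF.
Qed.

Lemma J_representationB_simple f u t :
  J_representation f u -> is_integrable_simple mu D t ->
  J_representation (f - inter_sum (simple_integral mu D t))
    (fun s => u s - s *: t s).
Proof.
move=> [mu_ fu] st; split.
  apply: strongly_measurableB => //.
  exact: strongly_measurable_mul_id (strongly_measurable_simple _ st.1).
rewrite -simple_integral_linear//.
apply: (eq_is_bochner_integral (@cancel_weight u t)).
apply: is_bochner_integralB_simple => //.
exact: is_integrable_simple_linear.
Qed.

(** The [t_ n] are simple approximations of [u(s)/s], cut down to the sets [B n]
    below.  The cut makes [J_functional (u s) s] a bound for the errors without
    spoiling the convergence. *)
Lemma simple_J_approximation u : strongly_measurable mu D u ->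
  exists t_ : nat -> line -> inter_space X,
    [/\ forall n, is_integrable_simple mu D (t_ n),
        forall n s, J_functional (u s - (s : R) *: t_ n s) s
          <= J_functional (u s) s &
        {ae mu, forall s : line, D s ->
          J_functional (u s - (s : R) *: t_ n s) s @[n --> \oo] --> (0 : R)}].
Proof.
move=> su; have mD := @measurable_half_line R.
have [v [sv vU]] : strongly_measurable mu D (fun s => (s : R)^-1 *: u s).
  apply: strongly_measurableZ => //.
  apply: (eq_measurable_fun (fun s : line => (s : R) `^ (-1))) => [s|].
    by rewrite inE half_line_gt0 => /ltW; exact: powR_inv1.
  by apply: measurable_fun_line; exact: measurable_powR.
pose err n s := J_functional (u s - (s : R) *: v n s) s.
pose B n : set line := D `&` [set s | err n s <= J_functional (u s) s]
  `&` `]0, n%:R]%classic.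
have mB n : measurable (B n).
  apply: measurableI; last by apply: measurable_line; exact: measurable_itv.
  apply: measurable_fun_le => //; apply: measurable_J_functional => //.
  apply: strongly_measurableB => //; apply: strongly_measurable_mul_id.
  exact: strongly_measurable_simple.
pose t_ n s := if s \in B n then v n s else 0.
exists t_; split=> [n|n s|].
- have hv : finitely_valued D (fun s => (v n s, s \in B n)).
    by apply: finitely_valued_pair; [exact: sv|exact: finitely_valued_mem].
  apply: (is_integrable_simple_comp
    (g := fun p : inter_space X * bool => if p.2 then p.1 else 0) hv).
  move=> [y [|]]; last by rewrite eqxx.
  move=> _; apply: (@le_lt_trans _ _ (mu (`]0, n%:R]%classic : set line))).
    apply: le_measure; rewrite ?inE.
    + exact: hv.2.
    + by apply: measurable_line; exact: measurable_itv.
    + by move=> s [_ [_ /set_mem[]]].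
  by rewrite completed_lebesgue_measure_oc// ltry.
- rewrite /t_; case: ifPn => [/set_mem[[]]//|_].
  by rewrite scaler0 subr0.
- apply: filterS vU => s vs Ds; have s0 : 0 < s by rewrite -half_line_gt0.
  have errs : err n s @[n --> \oo] --> 0.
    have u_v : u s - (s : R) *: v n s @[n --> \oo] --> (0 : inter_space X).
      rewrite -(subrr (u s)); apply: cvgB; first exact: cvg_cst.
      rewrite -[X in _ --> X]scale1r -(@mulfV _ s) ?gt_eqF// -scalerA.
      by apply: cvgZr; exact: vs.
    have := cvg_comp _ _ u_v (@J_functional_continuous _ X s 0).
    by rewrite J_functional0.
  (* at a zero of J(u(s), s) the cut may be active for all n, but then the error
     is bounded by 0 *)
  have [Ju0|Ju0] := leP (J_functional (u s) s) 0.
    rewrite (_ : (fun n => _) = cst 0); first exact: cvg_cst.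
    apply/funext => n; apply/eqP; rewrite eq_le J_functional_ge0 andbT.
    rewrite (le_trans _ Ju0)// /t_; case: ifPn => [/set_mem[[]]//|_].
    by rewrite scaler0 subr0.
  apply: cvg_trans (errs); apply: near_eq_cvg; near=> n.
  rewrite /t_ mem_set//; split; first split=> //=.
    by near: n; exact: cvgr_le errs _ Ju0.
  rewrite /= in_itv/= s0/=; near: n; exact: nbhs_infty_ger.
Unshelve. all: by end_near. Qed.

End representation.

(** * Weighted norms *)

Lemma cvg_powR0 (R : realType) (q : R) (x : nat -> R) : 0 < q ->
  (forall n, 0 <= x n) -> x n @[n --> \oo] --> 0 -> x n `^ q @[n --> \oo] --> 0.
Proof.
move=> q0 x0 /cvgr0Pnorm_lt cx; apply/cvgr0Pnorm_lt => e e0.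
have := cx (e `^ q^-1) (powR_gt0 _ e0); apply: filterS => n /=.
rewrite !ger0_norm ?powR_ge0// => xe.
rewrite -[ltRHS]powRr1 ?(ltW e0)// -(@mulVf _ q) ?gt_eqF// powRrM.
by apply: gt0_ltr_powR; rewrite ?nnegrE ?powR_ge0.
Qed.

Section weighted_norm.
Context (R : realType) (X : compatible_couple R) (q : R) (a : R -> R).
Local Notation line := (lebesgue_line R).
Local Notation mu := (@completed_lebesgue_measure R).
Local Notation D := (@half_line R : set line).
Hypotheses (q_gt0 : 0 < q) (a_gt0 : forall s, half_line s -> 0 < a s).
Hypothesis ma : measurable_fun D a.
Implicit Types (u v : line -> inter_space X).

Lemma J_weighted_ge0 u s : half_line s -> 0 <= J_weighted q a u s.
Proof.
by move=> Ds; rewrite !mulr_ge0 ?powR_ge0 ?J_functional_ge0// ltW// a_gt0.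
Qed.

Lemma J_weighted_normE u : J_weighted_norm q a u =
  ((\int[mu]_(s in D) (J_weighted q a u s `^ q)%:E) `^ q^-1)%E.
Proof.
rewrite /J_weighted_norm unlock [in RHS]integral_mkcond; congr (_ `^ _)%E.
apply: eq_integral => s _; rewrite /= !patchE; case: ifPn => [/set_mem Ds|_].
  by rewrite /= ger0_norm// J_weighted_ge0.
by rewrite (_ : point = 0 :> R)// normr0 powR0// gt_eqF.
Qed.

Lemma measurable_J_weighted u : strongly_measurable mu D u ->
  measurable_fun D (fun s => (J_weighted q a u s `^ q)%:E).
Proof.
move=> su; apply/measurable_EFinP.
apply: (measurableT_comp (measurable_powR q)).
apply: measurable_funM; first apply: measurable_funM => //.
  by apply: measurable_fun_line; exact: measurable_powR.
exact: measurable_J_functional.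
Qed.

(** Dominated convergence for the [q]-th powers of the weighted integrands, with
    that of [u] as dominating function. *)
Lemma J_weighted_norm_cvg0 u (v : nat -> line -> inter_space X) :
  strongly_measurable mu D u -> (forall n, strongly_measurable mu D (v n)) ->
  (J_weighted_norm q a u < +oo)%E ->
  (forall n s, J_functional (v n s) s <= J_functional (u s) s) ->
  {ae mu, forall s : line, D s ->
     J_functional (v n s) s @[n --> \oo] --> (0 : R)} ->
  forall e : R, 0 < e -> exists n, (J_weighted_norm q a (v n) < e%:E)%E.
Proof.
move=> su sv uoo vu v0 e e0.
have mD := @measurable_half_line R.
have powD w (s : R) : (0 <= J_weighted q a w s `^ q)%R by exact: powR_ge0.
have int_u : mu.-integrable D (fun s => (J_weighted q a u s `^ q)%:E).
  apply/integrableP; split; first exact: measurable_J_weighted.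
  under eq_integral do rewrite gee0_abs ?lee_fin//.
  move: uoo; rewrite J_weighted_normE; apply: lty_poweRy.
  by rewrite invr_eq0 gt_eqF.
have cvg_v : {ae mu, forall s, D s ->
    (J_weighted q a (v n) s `^ q)%:E @[n --> \oo] --> 0%E}.
  apply: filterS v0 => s vs Ds; apply/fine_cvgP; split; first exact: nearW.
  apply: cvg_powR0 => // [n|]; first exact: J_weighted_ge0.
  rewrite -(mulr0 (s `^ (- q^-1) * a s)).
  by apply: cvgMr; exact: vs.
have le_v : {ae mu, forall s n, D s ->
    (`|(J_weighted q a (v n) s `^ q)%:E| <= (J_weighted q a u s `^ q)%:E)%E}.
  apply: aeW => s n Ds; rewrite gee0_abs ?lee_fin//.
  apply: ge0_ler_powR; rewrite ?nnegrE ?J_weighted_ge0// ?(ltW q_gt0)//.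
  by rewrite ler_wpM2l// mulr_ge0 ?powR_ge0// ltW// a_gt0.
have [_ _] := dominated_convergence mD (fun n => measurable_J_weighted (sv n))
  (measurable_cst 0%E) cvg_v int_u le_v.
rewrite integral0 => /fine_cvgP[fin /cvgr0_norm_lt/(_ _ (powR_gt0 q e0)) lt_e].
have [n [/= fn ltn]] := filter_ex (filterI fin lt_e).
exists n; rewrite J_weighted_normE -(fineK fn) poweR_EFin lte_fin.
have I0 : (0 <= \int[mu]_(s in D) (J_weighted q a (v n) s `^ q)%:E)%E.
  by apply: integral_ge0 => s _; rewrite lee_fin.
rewrite -[ltRHS]powRr1 ?(ltW e0)// -(@mulfV _ q) ?gt_eqF// powRrM.
apply: gt0_ltr_powR; rewrite ?nnegrE ?powR_ge0 ?invr_gt0 ?fine_ge0//.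
by move: ltn; rewrite ger0_norm// fine_ge0.
Qed.

End weighted_norm.

(** * The intersection inside the J-space *)

(** The function [s a(s)] is dominated by a nondecreasing one, which is bounded
    by its value at [y]. *)
Lemma slowly_varying_bounded (R : realType) (a : R -> R) (x y : R) :
  slowly_varying a -> 0 < x ->
  exists M, forall s, x <= s -> s <= y -> a s <= M.
Proof.
move=> [a_gt0 _ /(_ 1 ltr01)[[g g_nd [[c c0 ag] _]] _]] x0.
exists (c * g y / x) => s xs sy.
have s0 : 0 < s by exact: lt_le_trans xs.
have [Ds Dy] : half_line s /\ half_line y.
  by rewrite !half_line_gt0; split => //; exact: lt_le_trans sy.
rewrite ler_pdivlMr//; apply: (@le_trans _ _ (a s * s)).
  by rewrite ler_wpM2l// ltW// a_gt0.
have /= := ag s Ds; rewrite powRr1 ?(ltW s0)// mulrC => /le_trans; apply.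
by rewrite ler_pM2l// g_nd.
Qed.

Section density.
Context (R : realType) (X : compatible_couple R) (q : R) (a : R -> R).
Local Notation line := (lebesgue_line R).
Local Notation mu := (@completed_lebesgue_measure R).
Local Notation D := (@half_line R : set line).
Hypotheses (q_gt0 : 0 < q) (sva : slowly_varying a).

Let a_gt0 s : half_line s -> 0 < a s. Proof. by case: sva => + _ _; exact. Qed.
Let ma : measurable_fun D a. Proof. by case: sva. Qed.

(** The representing function [s 1_A(s) f] is supported in an interval [A] of
    measure [1], away from [0] and infinity, where [a] is bounded. *)
Lemma range_inter_sum_sub_J_space : range (@inter_sum R X) `<=` J_space q a.
Proof.
move=> _ [f _ <-]; pose A : set line := `]1, 2]%classic.
have mA : measurable A by apply: measurable_line; exact: measurable_itv.
have AD : A `<=` D.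
  by move=> s; rewrite half_line_gt0 /A/= in_itv/= => /andP[/(lt_trans ltr01)].
have muA : mu A = 1%E.
  by rewrite completed_lebesgue_measure_oc ?ler1n// -(natrB _ (leqnSn 1)).
pose g (b : bool) := if b then f else 0.
pose t (s : line) := g (s \in A).
have hA := finitely_valued_mem (@measurable_half_line R) mA.
have A1 : D `&` (fun s => s \in A) @^-1` [set true] = A.
  apply/seteqP; split=> s /=; first by move=> [_ /set_mem].
  by move=> As; split; [exact: AD|exact: mem_set].
have gfin b : g b != 0 ->
    (mu (D `&` (fun s => s \in A) @^-1` [set b]) < +oo)%E.
  by case: b => [_|]; rewrite ?eqxx// A1 muA ltry.
have st : is_integrable_simple mu D t by exact: is_integrable_simple_comp hA gfin.
have tf : simple_integral mu D t = f.
  rewrite (simple_integral_comp hA gfin) -(fsbig_widen [set true]).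
  - rewrite fsbig_set1 A1 -[RHS]scale1r; congr (_ *: _).
    exact: (congr1 fine muA).
  - by move=> _ ->; exists (2 : R); [rewrite half_line_gt0|];
      rewrite // mem_set// /A/= in_itv/= lexx ltr1n.
  - by move=> [|] [_] //= _; rewrite scaler0.
have rep := J_representation_simple st; rewrite tf in rep.
split; first by eexists; exact: rep.
apply: (@le_lt_trans _ _ (J_weighted_norm q a (fun s => s *: t s))).
  by apply: ereal_inf_lbound; eexists; first exact: rep.
rewrite J_weighted_normE//; apply: poweR_lty.
have [M aM] := slowly_varying_bounded 2 sva ltr01.
(* J(s f, s) <= C for s in A, because s <= 2 there *)
pose C := maxr (2 * `|f.1|) (2 * (2 * `|f.2|)).
have W0 s : half_line s -> 0 <= J_weighted q a (fun s => s *: t s) s.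
  exact: J_weighted_ge0.
have -> : (\int[mu]_(s in D) (J_weighted q a (fun s => s *: t s) s `^ q)%:E =
    \int[mu]_(s in A) (J_weighted q a (fun s => s *: t s) s `^ q)%:E)%E.
  rewrite integral_mkcond [RHS]integral_mkcond; apply: eq_integral => s _.
  rewrite !patchE; case: ifPn => [_|]; case: ifPn => //.
    move=> /negbTE sA; rewrite /J_weighted /t sA/= scaler0 J_functional0 mulr0.
    by rewrite powR0// gt_eqF.
  by move=> /set_mem/AD/mem_set ->.
apply: (@le_lt_trans _ _ (\int[mu]_(s in A) (cst ((M * C) `^ q)%:E s))%E).
  apply: ge0_le_integral => //.
  - by move=> s _; rewrite lee_fin powR_ge0.
  - apply: measurable_funS AD (measurable_J_weighted _ _ rep.1) => //.
    exact: measurable_half_line.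
  move=> s As; rewrite lee_fin; have := As; rewrite /A/= in_itv/= => /andP[s1 s2].
  have s0 : 0 < s by exact: lt_trans s1.
  have Ja : J_weighted q a (fun s => s *: t s) s <= M * C.
    rewrite /J_weighted ler_pM ?J_functional_ge0//.
    + by rewrite mulr_ge0 ?powR_ge0// ltW// a_gt0//; exact: AD.
    + rewrite -[leRHS]mul1r ler_pM ?powR_ge0 ?aM ?(ltW s1)//.
        by rewrite ltW// a_gt0//; exact: AD.
      rewrite -(powRr0 s); apply: ler_powR; first exact: ltW.
      by rewrite oppr_le0 invr_ge0 ltW.
    + rewrite /t mem_set// /g /J_functional /C /= !normrZ gtr0_norm//.
      apply: le_max2; first by rewrite ler_wpM2r.
      by rewrite ler_pM ?mulr_ge0 ?(ltW s0)// ler_wpM2r.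
  apply: ge0_ler_powR; rewrite ?nnegrE ?(ltW q_gt0)//; first exact/W0/AD.
  by apply: le_trans Ja; exact/W0/AD.
by rewrite integral_cst// [X in (_ * X)%E]muA mule1 ltry.
Qed.

Lemma J_space_approximation (f : sum_space X) (e : R) :
  J_space q a f -> 0 < e ->
  exists2 g, range (@inter_sum R X) g & (J_norm q a (f - g)%R < e%:E)%E.
Proof.
move=> [_ /ereal_inf_lt[_ [u fu <-] u_fin]] e0.
have [t_ [st tu t0]] := simple_J_approximation fu.1.
have rep n := J_representationB_simple fu (st n).
have [n ltn] := J_weighted_norm_cvg0 q_gt0 a_gt0 ma fu.1 (fun n => (rep n).1)
  u_fin tu t0 e0.
exists (inter_sum (simple_integral mu D (t_ n))).
  by exists (simple_integral mu D (t_ n)).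
by apply: le_lt_trans ltn; apply: ereal_inf_lbound; eexists; first exact: rep.
Qed.

End density.

Theorem theorem1p16 (R : realType) (X : compatible_couple R) (q q' : R)
    (a : R -> R) :
  1 < q -> q^-1 + q'^-1 = 1 ->
  slowly_varying a ->
  (\int[@completed_lebesgue_measure R]_(t in @half_line R)
     (t^-1 * a t `^ (- q'))%:E < +oo)%E ->
  dense_for (J_norm q a) (J_space q a) (range (@inter_sum R X)).
Proof.
move=> q_gt1 _ sva _; have q_gt0 := lt_trans ltr01 q_gt1.
split; first exact: range_inter_sum_sub_J_space.
by move=> f Jf e e0; exact: J_space_approximation.
Qed.
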